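(* Let $G_1$ and $G_2$ be two Hamiltonian graphs such that $e_1\in E(G_1)$ and $e_2\in E(G_2)$. The graph $G=G_1(e_1)\#G_2(e_2)$, obtained by a 2-cut connection on $e_1$ and $e_2$, is 2FH if and only if every 2-factor of $G_1$ is a Hamiltonian cycle containing $e_1$ and every 2-factor of $G_2$ containing $e_2$ is a Hamiltonian cycle (or vice-versa, that is, the same condition with the roles of $(G_1,e_1)$ and $(G_2,e_2)$ exchanged).
   Context: Graphs are finite and connected, may have multiple (parallel) edges, and have no loops; $G_1$ and $G_2$ need not be regular. A $2$-factor of a graph is a $2$-regular spanning subgraph (not necessarily connected), and a Hamiltonian cycle is a connected $2$-factor. A graph is Hamiltonian if it has a Hamiltonian cycle. A Hamiltonian graph is 2FH (2-factor Hamiltonian) if each of its $2$-factors is a Hamiltonian cycle. 2-cut connection: let $e_1=x_1y_1\in E(G_1)$ and $e_2=x_2y_2\in E(G_2)$, with $G_1,G_2$ vertex-disjoint. A 2-cut connection on $e_1$ and $e_2$ constructs the graph $(G_1-e_1)\cup(G_2-e_2)\cup\{x_1x_2,y_1y_2\}$; $G_1(e_1)\#G_2(e_2)$ denotes either this graph or the one obtained by swapping the roles of $x_2$ and $y_2$.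
   Formalization: The condition on G_2 also requires that some 2-factor of G_2 contains e_2 (likewise for G_1, e_1 in the vice-versa case); without this the ''if'' direction fails, e.g. for a triangle G_1 and a 4-cycle plus a chord e_2 as G_2. *)

(* Defs.v *)
From mathcomp Require Import all_boot.

Set Implicit Arguments.
Unset Strict Implicit.
Unset Printing Implicit Defensive.

(* Distinct edges may have the same set of ends (parallel edges). *)
Record mgraph := MGraph {
  vertex : finType;
  edge : finType;
  ends : edge -> {set vertex};
  loopless : forall e, #|ends e| = 2
}.

Section Factors.

Variable G : mgraph.
Implicit Types (F : {set edge G}) (u v : vertex G).

(* A spanning subgraph of G is represented by its set F of edges. *)

Definition degree F v : nat := #|[set e in F | v \in ends e]|.

Definition adjacent F : rel (vertex G) :=
  fun u v => [exists e in F, ends e == [set u; v]].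

Definition connected F : bool :=
  [forall u, forall v, connect (adjacent F) u v].

Definition two_factor F : bool := [forall v, degree F v == 2].

(* Two parallel edges on two vertices form a cycle of length 2. *)
Definition hamiltonian_cycle F : bool := two_factor F && connected F.

End Factors.

Definition connected_graph (G : mgraph) : Prop := connected [set: edge G].

Definition hamiltonian (G : mgraph) : Prop :=
  exists F : {set edge G}, hamiltonian_cycle F.

Definition twoFH (G : mgraph) : Prop :=
  hamiltonian G /\
  forall F : {set edge G}, two_factor F -> hamiltonian_cycle F.

Section TwoCutConnection.

Variables (G1 G2 : mgraph) (e1 : edge G1) (e2 : edge G2).
Variables (x1 y1 : vertex G1) (x2 y2 : vertex G2).

Definition cut_vertex : finType := (vertex G1 + vertex G2)%type.

(* The edges of G1 - e1, those of G2 - e2, and the two new edges: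
   [true] is x1x2 and [false] is y1y2. *)
Definition cut_edge : finType :=
  ({e : edge G1 | e != e1} + {e : edge G2 | e != e2} + bool)%type.

Definition cut_ends (e : cut_edge) : {set cut_vertex} :=
  match e with
  | inl (inl f1) => [set inl v | v in ends (val f1)]
  | inl (inr f2) => [set inr v | v in ends (val f2)]
  | inr true => [set inl x1; inr x2]
  | inr false => [set inl y1; inr y2]
  end.

Lemma cut_loopless e : #|cut_ends e| = 2.
Proof.
case: e => [[f|f]|[]] /=; last 2 first.
- by rewrite cards2.
- by rewrite cards2.
- by rewrite card_imset ?loopless // => u v [].
- by rewrite card_imset ?loopless // => u v [].
Qed.

(* Meaningful when e1 = x1y1 and e2 = x2y2; exchanging x2 and y2 gives the
   other graph denoted by G1(e1)#G2(e2). *)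
Definition two_cut_connection : mgraph := MGraph cut_loopless.

End TwoCutConnection.

(* The assertion about the 2-factors of G2 containing e2 is not vacuous: at
   least one such 2-factor exists.  Without this, a chord e2 of a 4-cycle
   (which lies on no 2-factor) satisfies it, while no 2-cut connection on e2
   with an edge of a triangle is Hamiltonian.  For G1, the hamiltonicity of G1
   already provides a 2-factor. *)
Definition cut_condition (G1 : mgraph) (e1 : edge G1)
    (G2 : mgraph) (e2 : edge G2) : Prop :=
  [/\ forall F : {set edge G1}, two_factor F -> hamiltonian_cycle F /\ e1 \in F,
      exists F : {set edge G2}, two_factor F /\ e2 \in F
    & forall F : {set edge G2},
        two_factor F -> e2 \in F -> hamiltonian_cycle F].

(* Main.v *)
Require Import Defs.
From mathcomp Require Import all_boot.

(** A 2-factor meets every vertex cut in an even number of edges, so a 2-factor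
    of G contains both new edges or neither.  Trading the two new edges for e1
    and e2, the 2-factors of G are the pairs of 2-factors A of G1 and B of G2
    with e1 in A iff e2 in B; such a pair is a Hamiltonian cycle of G iff A and
    B are Hamiltonian cycles through e1 and e2.  If G is 2FH, no
    pair avoids both e1 and e2, so e1 lies in all 2-factors of G1 or e2 in all
    2-factors of G2. *)

Set Implicit Arguments.
Unset Strict Implicit.
Unset Printing Implicit Defensive.

(** * Connectivity and vertex cuts of a spanning subgraph *)

Section Connectivity.

Variable G : mgraph.
Implicit Types (F : {set edge G}) (C : {set vertex G}).

Lemma connect_adjacentC F : connect_sym (adjacent F).
Proof.
apply: sym_connect_sym => u v; rewrite /adjacent.
by apply: eq_existsb => e; rewrite [[set v; u]]setUC.
Qed.

Lemma connect_ends F e u v :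
  e \in F -> u \in ends e -> v \in ends e -> connect (adjacent F) u v.
Proof.
move=> eF ue ve; have [->|uv] := eqVneq u v; first exact: connect0.
apply/connect1/existsP; exists e; rewrite eF /= eq_sym eqEcard.
by rewrite subUset !sub1set ue ve loopless cards2 uv.
Qed.

(** Path induction edge by edge. Below, [e'] is either connectivity in another edge set, pulled back
    along a map of vertices where needed, or lying on the same side of the cut. *)
Lemma connect_ind_ends F (e' : rel (vertex G)) u v :
  reflexive e' -> transitive e' ->
  (forall e w z, e \in F -> w \in ends e -> z \in ends e -> e' w z) ->
  connect (adjacent F) u v -> e' u v.
Proof.
move=> e'xx e'tr step /connectP[p + ->]; elim: p u => [|w p IHp] u //=.
case/andP=> /existsP[e /andP[eF /eqP ends_e]] /IHp; apply: e'tr.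
by apply: (step e); rewrite // ends_e ?set21 ?set22.
Qed.

(** Double counting of the incidences between [C] and [F]. *)
Lemma sum_degree F C :
  \sum_(v in C) degree F v = \sum_(e in F) #|ends e :&: C|.
Proof.
transitivity (\sum_(v in C) \sum_(e in F) (v \in ends e)).
  apply: eq_bigr => v _; rewrite /degree -sum1dep_card big_mkcondr /=.
  by apply: eq_bigr => e _; case: ifP.
rewrite exchange_big /=; apply: eq_bigr => e _.
rewrite -sum1_card big_mkcond [RHS]big_mkcond /=.
by apply: eq_bigr => v _; rewrite inE; case: (v \in C) (v \in ends e) => [] [].
Qed.

(* The number of edges of a 2-factor leaving C is even, so it is not 1. *)
Lemma two_factor_cut F C e u v :
    two_factor F -> e \in F -> u \in ends e -> v \in ends e ->
    u \in C -> v \notin C ->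
  exists2 f, f \in F :\ e & exists w z,
    [/\ w \in ends f, z \in ends f, w \in C & z \notin C].
Proof.
move=> /forallP tfF eF ue ve uC vC.
have [/exists_inP[f fF /andP[/set0Pn[w]]]|] := boolP [exists f in F :\ e,
    (ends f :&: C != set0) && (ends f :\: C != set0)].
  move=> /setIP[wf wC] /set0Pn[z /setDP[zf zC]].
  by exists f => //; exists w, z.
rewrite negb_exists => /forallP no_cut.
(* The sum is twice the size of [C]. An edge leaving [C] contributes 1 and any other edge 0 or 2, so
   [e] cannot be the only one that leaves. *)
have: odd (\sum_(g in F) #|ends g :&: C|) = false.
  rewrite -sum_degree (eq_bigr (fun=> 2)) => [|w _]; last exact/eqP.
  by rewrite sum_nat_const oddM andbF.
have e_cut: #|ends e :&: C| = 1.
  have := cardsID C (ends e); rewrite loopless.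
  have: 0 < #|ends e :&: C| by apply/card_gt0P; exists u; rewrite inE ue.
  have: 0 < #|ends e :\: C| by apply/card_gt0P; exists v; rewrite inE ve vC.
  by case: #|_ :&: C| #|_ :\: C| => [|[|[|?]]] [|[|[|?]]].
rewrite (big_setD1 e) //= e_cut oddD.
suff ->: odd (\sum_(g in F :\ e) #|ends g :&: C|) = false by [].
apply: (big_ind (fun n => odd n = false)) => // [m n|f fF].
  by rewrite oddD => -> ->.
have := no_cut f; rewrite fF /= negb_and !negbK => /orP[]/eqP f_cut.
  by rewrite f_cut cards0.
by have := cardsID C (ends f); rewrite f_cut cards0 addn0 loopless => ->.
Qed.

(** A 2-factor has no bridge: if the ends of [e] were separated in [F :\ e], then [e] alone would
    leave the component of one of them, against parity. *)
Lemma hamiltonian_cycleD1 F e : hamiltonian_cycle F -> connected (F :\ e).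
Proof.
case/andP=> tfF /forallP cF; apply/forallP => u; apply/forallP => v.
apply: (connect_ind_ends (F := F) (e' := connect (adjacent (F :\ e)))).
- exact: connect0.
- exact: connect_trans.
- move=> f w z fF wf zf; have [fe|fe] := eqVneq f e; last first.
    by apply: (connect_ends (e := f)); rewrite // !inE fe.
  apply: contraT => wz.
  have [||g gF [s [t [sg tg ws /negP[]]]]] :=
    two_factor_cut (C := [set t | connect (adjacent (F :\ e)) w t])
      tfF fF wf zf.
  + by rewrite inE connect0.
  + by rewrite inE.
  move: ws; rewrite !inE => /connect_trans; apply.
  by apply: (connect_ends (e := g)); rewrite -?fe.
by have /forallP := cF u; apply.
Qed.

End Connectivity.

(** * Degrees and 2-factors in the 2-cut connection *)

Section FactorJoin.

Variables (G1 G2 : mgraph) (e1 : edge G1) (e2 : edge G2).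
Variables (x1 y1 : vertex G1) (x2 y2 : vertex G2).
Hypotheses (He1 : ends e1 = [set x1; y1]) (He2 : ends e2 = [set x2; y2]).

Notation G := (two_cut_connection e1 e2 x1 y1 x2 y2).
Implicit Types (A : {set edge G1}) (B : {set edge G2}) (F : {set edge G}).

(* Only used when (e1 \in A) = (e2 \in B): the two new edges then replace
   e1 and e2, or both are absent. *)
Definition factor_join A B : {set edge G} :=
  [set e : cut_edge e1 e2 | match e with
    | inl (inl f) => val f \in A
    | inl (inr f) => val f \in B
    | inr _ => e1 \in A
    end].

Lemma cut_vertex_eqE :
  ((forall u v : vertex G1, ((inl u : vertex G) == inl v) = (u == v)) *
   (forall u v : vertex G2, ((inr u : vertex G) == inr v) = (u == v))) *
  ((forall u v, ((inl u : vertex G) == inr v) = false) *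
   (forall u v, ((inr u : vertex G) == inl v) = false)).
Proof. by []. Qed.

Lemma inl_cut_ends u (S : {set vertex G1}) :
  ((inl u : cut_vertex G1 G2) \in [set inl v | v in S]) = (u \in S).
Proof. by rewrite mem_imset // => ? ? []. Qed.

Lemma inr_cut_ends u (S : {set vertex G2}) :
  ((inr u : cut_vertex G1 G2) \in [set inr v | v in S]) = (u \in S).
Proof. by rewrite mem_imset // => ? ? []. Qed.

Lemma inl_cut_endsF u (S : {set vertex G2}) :
  ((inl u : cut_vertex G1 G2) \in [set inr v | v in S]) = false.
Proof. by apply/imsetP => -[]. Qed.

Lemma inr_cut_endsF u (S : {set vertex G1}) :
  ((inr u : cut_vertex G1 G2) \in [set inl v | v in S]) = false.
Proof. by apply/imsetP => -[]. Qed.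

Definition cut_endsE :=
  (inl_cut_ends, inr_cut_ends, inl_cut_endsF, inr_cut_endsF).

Lemma new_ends1_neq : x1 != y1.
Proof. by have := loopless e1; rewrite He1 cards2; case: eqP. Qed.

Lemma new_ends2_neq : x2 != y2.
Proof. by have := loopless e2; rewrite He2 cards2; case: eqP. Qed.

Lemma sum_sub_neq (T : finType) (a : T) (P : pred T) :
  \sum_(x : {x : T | x != a}) P (val x) = \sum_(x | x != a) P x.
Proof.
rewrite [RHS](reindex_omap (val : {x : T | x != a} -> T) insub) /=.
  by apply: eq_bigl => x; rewrite valK eqxx (valP x).
by move=> x xa; rewrite insubT.
Qed.

Lemma degree_sum (H : mgraph) (S : {set edge H}) v :
  degree S v = \sum_e ((e \in S) && (v \in ends e)).
Proof.
rewrite /degree -sum1dep_card big_mkcond /=.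
by apply: eq_bigr => e _; case: andP.
Qed.

(** As [x1 != y1], each of these two vertices meets exactly one new edge, which stands in for
    [e1]. *)
Lemma degree_join_inl A B v :
  degree (factor_join A B) (inl v) = degree A v.
Proof.
rewrite !degree_sum big_sumType big_sumType big_bool /=.
rewrite (bigD1 e1) //= addnC; congr (_ + _); last first.
  rewrite [X in _ + X]big1 => [|f _]; last by rewrite cut_endsE andbF.
  rewrite addn0 -sum_sub_neq.
  by apply: eq_bigr => f _; rewrite inE cut_endsE.
rewrite He1 !inE !cut_vertex_eqE; have := new_ends1_neq.
case: (e1 \in A) => // /negPf xy.
by have [->|_] := eqVneq v x1; rewrite ?xy //; case: (v == y1).
Qed.

Lemma degree_join_inr A B v : (e1 \in A) = (e2 \in B) ->
  degree (factor_join A B) (inr v) = degree B v.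
Proof.
move=> AB; rewrite !degree_sum big_sumType big_sumType big_bool /=.
rewrite (bigD1 e2) //= addnC; congr (_ + _); last first.
  rewrite big1 => [|f _]; last by rewrite cut_endsE andbF.
  rewrite add0n -sum_sub_neq.
  by apply: eq_bigr => f _; rewrite inE cut_endsE.
rewrite He2 !inE !cut_vertex_eqE AB; have := new_ends2_neq.
case: (e2 \in B) => // /negPf xy.
by have [->|_] := eqVneq v x2; rewrite ?xy //; case: (v == y2).
Qed.

Lemma two_factor_join A B : (e1 \in A) = (e2 \in B) ->
  two_factor (factor_join A B) = two_factor A && two_factor B.
Proof.
move=> AB; apply/forallP/andP => [tfF|[/forallP tfA /forallP tfB] [v|v]].
- split; apply/forallP => v.
    by rewrite -(degree_join_inl A B) tfF.
  by rewrite -(degree_join_inr v AB) tfF.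
- by rewrite degree_join_inl.
- by rewrite degree_join_inr.
Qed.

(** Only the two new edges cross the cut around the vertices of [G1], so by parity one cannot occur
    without the other. *)
Lemma two_factor_new_edges F :
  two_factor F -> (inr true \in F) = (inr false \in F).
Proof.
move=> tfF.
have new b : inr b \in F -> inr (~~ b) \in F.
  pose C : {set vertex G} := [set inl v | v in [set: vertex G1]].
  move=> bF; have [||||f + [w [z []]]] := two_factor_cut (C := C)
      (u := inl (if b then x1 else y1)) (v := inr (if b then x2 else y2))
      tfF bF.
  - by case: b {bF}; rewrite !inE eqxx.
  - by case: b {bF}; rewrite !inE eqxx orbT.
  - by rewrite cut_endsE inE.
  - by rewrite cut_endsE.
  case: f => [[f|f]|c].
  - by case: z => z; rewrite /= ?cut_endsE ?inE.
  - by case: w => w; rewrite /= ?cut_endsE.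
  - by rewrite !inE => /andP[cb cF] _ _ _ _; case: b c cb cF {bF} => [] [].
by apply/idP/idP => /new.
Qed.

Lemma two_factor_joinP F : two_factor F ->
  exists A B, (e1 \in A) = (e2 \in B) /\ F = factor_join A B.
Proof.
move=> tfF.
(* [insub e] fails only at the deleted edge, which is put back exactly when [x1x2] is in [F]. *)
pose A := [set e | if insub e is Some f then inl (inl f) \in F
                   else inr true \in F].
pose B := [set e | if insub e is Some f then inl (inr f) \in F
                   else inr true \in F].
have eA : (e1 \in A) = (inr true \in F) by rewrite inE insubF ?eqxx.
exists A, B; split; first by rewrite eA inE insubF ?eqxx.
apply/setP => -[[f|f]|[]]; rewrite inE ?eA //.
- by rewrite inE valK.
- by rewrite inE valK.
- by rewrite two_factor_new_edges.
Qed.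

(** * Connectivity and Hamiltonicity across the two new edges *)

Lemma connect_join_inl A B u v :
  connected (A :\ e1) -> connect (adjacent (factor_join A B)) (inl u) (inl v).
Proof.
move=> /forallP/(_ u)/forallP/(_ v).
apply: (connect_ind_ends
  (e' := relpre inl (connect (adjacent (factor_join A B))))) => [w|w z t|].
- exact: connect0.
- exact: connect_trans.
move=> e w z /setD1P[ne eA] we ze.
by apply: (connect_ends (e := inl (inl (Sub e ne)) : edge G));
  rewrite /= ?inE ?cut_endsE.
Qed.

Lemma connect_join_inr A B u v :
  connected (B :\ e2) -> connect (adjacent (factor_join A B)) (inr u) (inr v).
Proof.
move=> /forallP/(_ u)/forallP/(_ v).
apply: (connect_ind_ends
  (e' := relpre inr (connect (adjacent (factor_join A B))))) => [w|w z t|].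
- exact: connect0.
- exact: connect_trans.
move=> e w z /setD1P[ne eB] we ze.
by apply: (connect_ends (e := inl (inr (Sub e ne)) : edge G));
  rewrite /= ?inE ?cut_endsE.
Qed.

(** Each cycle stays connected after losing [e1] or [e2], and [x1x2] then links the two sides. *)
Lemma hamiltonian_join A B : e1 \in A -> e2 \in B ->
  hamiltonian_cycle A -> hamiltonian_cycle B ->
  hamiltonian_cycle (factor_join A B).
Proof.
move=> eA eB hA hB; have AB : (e1 \in A) = (e2 \in B) by rewrite eA eB.
apply/andP; split.
  by rewrite two_factor_join //; case/andP: hA => ->; case/andP: hB.
have cA := hamiltonian_cycleD1 e1 hA; have cB := hamiltonian_cycleD1 e2 hB.
have x12 : connect (adjacent (factor_join A B)) (inl x1) (inr x2).
  by apply: (connect_ends (e := inr true : edge G));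
    rewrite /= ?inE ?eA ?eqxx ?orbT.
have cx u : connect (adjacent (factor_join A B)) (inl x1) u.
  case: u => u; first exact: connect_join_inl.
  exact/(connect_trans x12)/connect_join_inr.
apply/forallP => u; apply/forallP => v.
by apply: connect_trans (cx v); rewrite connect_adjacentC.
Qed.

(** If [e1] is not in [A], both new edges are absent and every edge of the join stays on one side,
    so [x1] and [x2] are separated. *)
Lemma connected_join_new A B : connected (factor_join A B) -> e1 \in A.
Proof.
move=> /forallP/(_ (inl x1))/forallP/(_ (inr x2)); apply: contraTT => eA.
apply/negP; pose same_side := [rel u v : vertex G | is_inl u == is_inl v].
case/(connect_ind_ends (e' := same_side))/idPn => [u|v u w /eqP /= ->||] //=.
by case=> [[e|e]|b] [w|w] [z|z]; rewrite /= inE ?cut_endsE ?(negPf eA).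
Qed.

(* Contracting the G2 side to x1 turns x1x2 into a loop and y1y2 into e1. *)
Lemma connected_joinl A B :
  e1 \in A -> connected (factor_join A B) -> connected A.
Proof.
move=> eA /forallP cF; apply/forallP => u; apply/forallP => v.
pose p (w : vertex G) := if w is inl w' then w' else x1.
have /forallP/(_ (inl v)) := cF (inl u).
apply: (connect_ind_ends
  (e' := relpre p (connect (adjacent A)))) => [w|w z t|].
- exact: connect0.
- exact: connect_trans.
case=> [[e|e]|b] w z; rewrite inE => eF wF zF.
- case: w z wF zF => w [] z; rewrite /= ?cut_endsE // => wF zF.
  exact: connect_ends eF wF zF.
- by case: w z wF zF => w [] z; rewrite /= ?cut_endsE.
have pP t : t \in ends (inr b : edge G) -> p t \in ends e1.
  rewrite He1; case: b {wF zF}; case: t => t;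
    by rewrite !inE !cut_vertex_eqE ?orbF /= ?eqxx => // ->; rewrite ?orbT.
exact: connect_ends eA (pP w wF) (pP z zF).
Qed.

(** Here the [G1] side is contracted to [x2], which turns [x1x2] into a loop and [y1y2] into
    [e2]. *)
Lemma connected_joinr A B : (e1 \in A) = (e2 \in B) ->
  e2 \in B -> connected (factor_join A B) -> connected B.
Proof.
move=> AB eB /forallP cF; apply/forallP => u; apply/forallP => v.
pose p (w : vertex G) := if w is inr w' then w' else x2.
have /forallP/(_ (inr v)) := cF (inr u).
apply: (connect_ind_ends
  (e' := relpre p (connect (adjacent B)))) => [w|w z t|].
- exact: connect0.
- exact: connect_trans.
case=> [[e|e]|b] w z; rewrite inE => eF wF zF.
- by case: w z wF zF => w [] z; rewrite /= ?cut_endsE.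
- case: w z wF zF => w [] z; rewrite /= ?cut_endsE // => wF zF.
  exact: connect_ends eF wF zF.
have pP t : t \in ends (inr b : edge G) -> p t \in ends e2.
  rewrite He2; case: b {wF zF}; case: t => t;
    by rewrite !inE !cut_vertex_eqE ?orbF /= ?eqxx => // ->; rewrite ?orbT.
exact: connect_ends eB (pP w wF) (pP z zF).
Qed.

Lemma hamiltonian_joinE A B : (e1 \in A) = (e2 \in B) ->
  hamiltonian_cycle (factor_join A B) =
  [&& e1 \in A, hamiltonian_cycle A & hamiltonian_cycle B].
Proof.
move=> AB; apply/idP/and3P => [/andP[tfF cF]|[eA hA hB]]; last first.
  by apply: hamiltonian_join; rewrite // -AB.
have eA := connected_join_new cF; move: tfF.
rewrite two_factor_join // /hamiltonian_cycle => /andP[-> ->].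
by rewrite eA (connected_joinl eA cF) (connected_joinr AB _ cF) -?AB.
Qed.

(** Every 2-factor of [G] is a join, so being 2FH can be tested on pairs of 2-factors of [G1] and
    [G2]; the theorem then reduces to choosing such pairs. *)
Lemma twoFH_joinP :
  twoFH G <->
  (exists A B, [/\ e1 \in A, e2 \in B, hamiltonian_cycle A
                 & hamiltonian_cycle B]) /\
  (forall A B, two_factor A -> two_factor B -> (e1 \in A) = (e2 \in B) ->
     [/\ e1 \in A, hamiltonian_cycle A & hamiltonian_cycle B]).
Proof.
split=> [[[F hF] allF]|[[A [B [eA eB hA hB]]] allAB]]; last first.
  split; first by exists (factor_join A B); apply: hamiltonian_join.
  move=> F tfF; have [A' [B' [AB defF]]] := two_factor_joinP tfF.
  move: tfF; rewrite defF two_factor_join // => /andP[tfA tfB].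
  by rewrite hamiltonian_joinE //; apply/and3P/allAB.
split=> [|A B tfA tfB AB]; last first.
  apply/and3P; rewrite -hamiltonian_joinE //; apply: allF.
  by rewrite two_factor_join // tfA.
have [A [B [AB defF]]] : exists A B, (e1 \in A) = (e2 \in B) /\
    F = factor_join A B by case/andP: hF => /two_factor_joinP.
move: hF; rewrite defF hamiltonian_joinE // => /and3P[eA hA hB].
by exists A, B; split; rewrite -?AB.
Qed.

End FactorJoin.

(** * From compatible pairs of 2-factors to conditions on each graph *)

Theorem theorem4p2 (G1 G2 : mgraph) (e1 : edge G1) (e2 : edge G2)
    (x1 y1 : vertex G1) (x2 y2 : vertex G2)
    (conn1 : connected_graph G1) (conn2 : connected_graph G2)
    (ham1 : hamiltonian G1) (ham2 : hamiltonian G2)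
    (He1 : ends e1 = [set x1; y1]) (He2 : ends e2 = [set x2; y2]) :
  twoFH (two_cut_connection e1 e2 x1 y1 x2 y2) <->
  cut_condition e1 e2 \/ cut_condition e2 e1.
Proof.
apply: iff_trans (twoFH_joinP He1 He2) _; split.
  case=> -[A0 [B0 [eA0 eB0 hA0 hB0]]] allAB.
  have [/andP[tfA0 _] /andP[tfB0 _]] := (hA0, hB0).
  (* Any 2-factor through [e1] is compatible with the fixed [B0], and symmetrically one through [e2]
     with [A0]. *)
  have hamA A : two_factor A -> e1 \in A -> hamiltonian_cycle A.
    by move=> tfA eA; case: (allAB A B0); rewrite ?eA ?eB0.
  have hamB B : two_factor B -> e2 \in B -> hamiltonian_cycle B.
    by move=> tfB eB; case: (allAB A0 B); rewrite ?eA0 ?eB.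
  have [/existsP[A /andP[tfA eA]]|] :=
      boolP [exists A : {set edge G1}, two_factor A && (e1 \notin A)].
    right; split=> [B tfB||//]; last by exists A0.
    (* Otherwise [A] and [B] avoid both [e1] and [e2], a compatible pair that [allAB] rules out. *)
    have eB : e2 \in B.
      apply: contraT => eB; case: (allAB A B) => //; last by rewrite (negPf eA).
      by rewrite (negPf eA) (negPf eB).
    by split=> //; apply: hamB.
  rewrite negb_exists => /forallP noA.
  left; split=> [A tfA||//]; last by exists B0.
  have eA : e1 \in A by have := noA A; rewrite tfA negbK.
  by split=> //; apply: hamA.
case=> [] [all1 [S [tfS eS]] all2].
(* A Hamiltonian cycle of [G1] must use [e1], so it pairs with [S], which is Hamiltonian by
   [all2]. *)
- have [A hA] := ham1; have [_ eA] := all1 A (andP hA).1.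
  split; first by exists A, S; split=> //; apply: all2.
  (* As [A'] contains [e1], compatibility forces [e2] into [B'], where [all2] applies. *)
  move=> A' B' tfA tfB AB; have [hA' eA'] := all1 A' tfA.
  by split=> //; apply: all2; rewrite -?AB.
- have [B hB] := ham2; have [_ eB] := all1 B (andP hB).1.
  split; first by exists S, B; split=> //; apply: all2.
  move=> A' B' tfA tfB AB; have [hB' eB'] := all1 B' tfB.
  have eA' : e1 \in A' by rewrite AB.
  by split=> //; apply: all2.
Qed.
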